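(* Let $\mathbf A,\mathbf B\in\mathbb R^{n\times n}$ be s.p.d. matrices, and define the set of s.p.d. transport matrices $\mathcal S^+_{\mathbf A\to\mathbf B}:=\{\mathbf T\in\mathbb R^{n\times n}\mid\mathbf T\succeq\mathbf 0,\ \mathbf T\mathbf A\mathbf T^*=\mathbf B\}$. The following statements are equivalent: 1. $\mathcal S^+_{\mathbf A\to\mathbf B}\ne\emptyset$. 2. The OT matrix from $\mathbf A$ to $\mathbf B$ is $N(0,\mathbf A)$-a.s. unique (i.e. an OT matrix exists and any two of them agree on $\mathcal R(\mathbf A)$). 3. $\mathbf B/\mathbf A=\mathbf 0$. 4. $\mathcal R(\mathbf B)=\mathcal R(\mathbf B\mathbf A)$. 5. $\mathcal R(\mathbf B)\cap\mathcal N(\mathbf A)=\{\mathbf 0\}$. Moreover, when any of these conditions hold, any s.p.d. transport matrix in $\mathcal S^+_{\mathbf A\to\mathbf B}$ is an OT matrix. A canonical choice for this matrix, which has minimal rank $\operatorname{rank}(\mathbf B^{1/2}\mathbf A^{1/2})$, is $$\mathbf S_{\mathbf A\to\mathbf B}:=\begin{pmatrix}(\mathbf G_{11}^* )^{-1}\mathbf C_{11}^{1/2}\mathbf G_{11}^{-1}&(\mathbf G_{11}^* )^{-1}\mathbf C_{11}^{\dagger/2}\mathbf G_{11}^*\mathbf B_{12}\\ \mathbf B_{21}\mathbf G_{11}\mathbf C_{11}^{\dagger/2}\mathbf G_{11}^{-1}&\mathbf B_{21}\mathbf G_{11}(\mathbf C_{11}^{\dagger/2})^3\mathbf G_{11}^*\mathbf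 B_{12}\end{pmatrix},\qquad\mathbf C_{11}:=\mathbf G_{11}^*\mathbf B_{11}\mathbf G_{11},$$ in block form with respect to $\mathcal H_1\oplus\mathcal H_2$, $\mathcal H_1=\mathcal R(\mathbf A)$, $\mathcal H_2=\mathcal N(\mathbf A)$. This construction is independent of the choice of Green's matrix $\mathbf G_{11}\in\mathcal G(\mathbf A_{11})$.
   Context: s.p.d. (or $\succeq\mathbf 0$) means symmetric positive semidefinite. $^*$ is the transpose, $^\dagger$ the Moore–Penrose pseudoinverse, $\mathbf C^{\dagger/2}:=(\mathbf C^{1/2})^\dagger$; $\mathcal R,\mathcal N$ are range and null space. A Green's matrix for $\mathbf A$, $\mathbf G\in\mathcal G(\mathbf A)$, is a square matrix with $\mathbf G\mathbf G^*=\mathbf A$. An OT matrix from $\mathbf A$ to $\mathbf B$ is $\mathbf T\in\mathbb R^{n\times n}$ with $\mathbf T\mathbf A\mathbf T^*=\mathbf B$ and $\operatorname{tr}(\mathbf A\mathbf T)=\operatorname{tr}[(\mathbf G^*\mathbf B\mathbf G)^{1/2}]$ for some (equivalently any) $\mathbf G\in\mathcal G(\mathbf A)$. Blocks: $\mathbf A_{11}=\mathbf A|_{\mathcal H_1}$ (invertible on $\mathcal H_1$), $\mathbf B_{ij}:\mathcal H_j\to\mathcal H_i$, $\mathbf G_{11}:\mathcal H_1\to\mathcal H_1$ with $\mathbf G_{11}\mathbf G_{11}^*=\mathbf A_{11}$. Schur complement: $\mathbf B/\mathbf A:=\mathbf B_{22}-\mathbf B_{21}\mathbf B_{11}^\dagger\mathbf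 B_{12}:\mathcal H_2\to\mathcal H_2$. *)

(* Defs.v *)
From HB Require Import structures.
From mathcomp Require Import all_boot all_order all_algebra.
From mathcomp Require Import boolp classical_sets.

Set Implicit Arguments.
Unset Strict Implicit.
Unset Printing Implicit Defensive.

Import Order.TTheory GRing.Theory Num.Theory.
Local Open Scope classical_set_scope.
Local Open Scope ring_scope.

Definition psdmx (R : rcfType) (n : nat) (A : 'M[R]_n) : Prop :=
  A^T = A /\ forall x : 'cV[R]_n, 0 <= (x^T *m A *m x) 0 0.

(* Vectors are columns here, whereas the row-space operations of mxalgebra
   act on rows. *)
Definition colspace (R : rcfType) (m n : nat) (A : 'M[R]_(m, n)) :
  set 'cV[R]_m := range (fun x : 'cV[R]_n => A *m x).

Definition nullspace (R : rcfType) (m n : nat) (A : 'M[R]_(m, n)) :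
  set 'cV[R]_n := [set x | A *m x = 0].

(* The positive semidefinite square root; it exists and is unique when A is
   psd, and the default value 0 is only taken otherwise. *)
Definition sqrtmx (R : rcfType) (n : nat) (A : 'M[R]_n) : 'M[R]_n :=
  xget 0 [set S | psdmx S /\ S *m S = A].

(* The Moore-Penrose pseudoinverse, through the four Penrose equations (they
   always have exactly one solution).  It is not mxalgebra's pinvmx, which is
   only a partial inverse. *)
Definition mp_pinvmx (R : rcfType) (m n : nat) (A : 'M[R]_(m, n)) :
  'M[R]_(n, m) :=
  xget 0 [set X | [/\ A *m X *m A = A, X *m A *m X = X,
                      (A *m X)^T = A *m X & (X *m A)^T = X *m A]].

Definition green (R : rcfType) (n : nat) (A : 'M[R]_n) : set 'M[R]_n :=
  [set G | G *m G^T = A].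

Definition OTmx (R : rcfType) (n : nat) (A B : 'M[R]_n) : set 'M[R]_n :=
  [set T | T *m A *m T^T = B /\
    exists2 G, green A G & \tr (A *m T) = \tr (sqrtmx (G^T *m B *m G))].

Definition psd_transport (R : rcfType) (n : nat) (A B : 'M[R]_n) :
  set 'M[R]_n := [set T | psdmx T /\ T *m A *m T^T = B].

(* The columns of U1 and U2 are orthonormal bases of H1 = R(A) and H2 = N(A).
   Operators between the Hj are represented by their matrices in these bases,
   so that transposition is the adjoint. *)
Definition adapted_bases (R : rcfType) (n : nat) (A : 'M[R]_n)
    (U1 : 'M[R]_(n, \rank A)) (U2 : 'M[R]_(n, n - \rank A)) : Prop :=
  [/\ U1^T *m U1 = 1%:M, colspace U1 = colspace A,
      U2^T *m U2 = 1%:M & colspace U2 = nullspace A].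
Arguments adapted_bases {R n} A U1 U2.

(* The block of B mapping the span of V to the span of U. *)
Definition block_of (R : rcfType) (n p q : nat) (U : 'M[R]_(n, p))
    (V : 'M[R]_(n, q)) (B : 'M[R]_n) : 'M[R]_(p, q) := U^T *m B *m V.

Definition schur (R : rcfType) (n p q : nat) (U1 : 'M[R]_(n, p))
    (U2 : 'M[R]_(n, q)) (B : 'M[R]_n) : 'M[R]_q :=
  block_of U2 U2 B
  - block_of U2 U1 B *m mp_pinvmx (block_of U1 U1 B) *m block_of U1 U2 B.

Definition canonical_transport (R : rcfType) (n p q : nat)
    (U1 : 'M[R]_(n, p)) (U2 : 'M[R]_(n, q)) (B : 'M[R]_n) (G11 : 'M[R]_p) :
    'M[R]_n :=
  let B12 := block_of U1 U2 B in
  let B21 := block_of U2 U1 B in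
  let C11 := G11^T *m block_of U1 U1 B *m G11 in
  let Chalf := sqrtmx C11 in
  let Cdhalf := mp_pinvmx Chalf in
  let U := row_mx U1 U2 in
  U *m block_mx
         (invmx G11^T *m Chalf *m invmx G11)
         (invmx G11^T *m Cdhalf *m G11^T *m B12)
         (B21 *m G11 *m Cdhalf *m invmx G11)
         (B21 *m G11 *m (Cdhalf *m Cdhalf *m Cdhalf) *m G11^T *m B12)
    *m U^T.

Lemma orthonormal_row_basis (R : rcfType) (n d : nat) (V : 'M[R]_n) :
  \rank V = d ->
  exists2 Q : 'M[R]_(d, n), Q *m Q^T = 1%:M & (Q :=: V)%MS.
Proof.
elim: d V => [|d IH] V rV.
  exists 0; first by apply/matrixP => -[].
  by move/eqP: rV; rewrite mxrank_eq0 => /eqP ->; apply/eqmxP; rewrite !sub0mx.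
have /rowV0Pn[v vV v0] : V != 0 by rewrite -mxrank_eq0 rV.
have vvE : (v *m v^T) 0 0 = \sum_j v 0 j ^+ 2.
  by rewrite !mxE; apply: eq_bigr => j _; rewrite mxE expr2.
have vv_gt0 : 0 < (v *m v^T) 0 0.
  rewrite vvE lt_neqAle sumr_ge0 ?andbT => [|j _]; last exact: sqr_ge0.
  apply: contraNneq v0 => /esym/eqP.
  rewrite psumr_eq0 => [/allP h|j _]; last exact: sqr_ge0.
  apply/eqP/rowP => j; rewrite mxE; apply/eqP.
  by rewrite -sqrf_eq0; apply: h; rewrite mem_index_enum.
pose q := (Num.sqrt ((v *m v^T) 0 0))^-1 *: v.
have qq : q *m q^T = 1%:M.
  rewrite /q linearZ /= -scalemxAl -scalemxAr scalerA.
  rewrite -invfM -expr2 sqr_sqrtr ?ltW //; set c := (v *m _) 0 0 in vv_gt0 *.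
  by rewrite [v *m _]mx11_scalar -/c scale_scalar_mx mulVf ?gt_eqF.
have qV : (q <= V)%MS by rewrite scalemx_sub.
have rV' : \rank (V :&: kermx q^T)%MS = d.
  have := mxrank_mul_ker V q^T; rewrite rV.
  suff -> : \rank (V *m q^T) = 1 by move=> [].
  apply/eqP; rewrite eqn_leq rank_leq_col lt0n mxrank_eq0.
  apply: contraTneq qV => Vq0; apply/negP => /submxP[u uq].
  have : q *m q^T = 0 by rewrite {1}uq -mulmxA Vq0 mulmx0.
  by rewrite qq => /matrixP/(_ 0 0)/eqP; rewrite !mxE eqxx oner_eq0.
have [Q QQ QV] := IH _ rV'.
have Qq : Q *m q^T = 0.
  by apply/eqP; rewrite -sub_kermx QV capmxSr.
have qQ : q *m Q^T = 0 by rewrite -[q]trmxK -trmx_mul Qq trmx0.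
have CC : col_mx q Q *m (col_mx q Q)^T = 1%:M :> 'M_(1 + d).
  by rewrite tr_col_mx mul_col_row qq QQ Qq qQ -scalar_mx_block.
exists (col_mx q Q); first exact: CC.
have sub : (col_mx q Q <= V)%MS by rewrite col_mx_sub qV QV capmxSl.
have rC : \rank (col_mx q Q) = d.+1.
  have := mxrankM_maxl (col_mx q Q) (col_mx q Q)^T.
  rewrite CC mxrank1 => le_dC; apply/eqP.
  by rewrite eqn_leq (rank_leq_row (col_mx q Q)).
by apply/eqmxP; have [_ <-] := mxrank_leqif_eq sub; rewrite rV rC.
Qed.

Lemma colspaceP (R : rcfType) (m n : nat) (A : 'M[R]_(m, n)) (x : 'cV[R]_m) :
  colspace A x <-> (x^T <= A^T)%MS.
Proof.
split=> [[y _ <-]|/submxP[u xE]]; first by rewrite trmx_mul submxMl.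
by exists u^T => //; rewrite -[x]trmxK xE trmx_mul trmxK.
Qed.

Lemma adapted_bases_exist (R : rcfType) (n : nat) (A : 'M[R]_n) :
  A^T = A -> exists U1 U2, adapted_bases A U1 U2.
Proof.
move=> AT; have [Q1 QQ1 E1] := orthonormal_row_basis (erefl (\rank A)).
have [Q2 QQ2 E2] := orthonormal_row_basis (mxrank_ker A).
exists Q1^T, Q2^T; split; rewrite ?trmxK //; apply/seteqP; split=> x.
- by move=> /colspaceP; rewrite trmxK E1 => h; apply/colspaceP; rewrite AT.
- by move=> /colspaceP; rewrite AT => h; apply/colspaceP; rewrite trmxK E1.
- move=> /colspaceP; rewrite trmxK E2 => /sub_kermxP.
  by rewrite -{1}AT -trmx_mul -[RHS]trmx0 => /trmx_inj.
- move=> Ax; apply/colspaceP; rewrite trmxK E2; apply/sub_kermxP.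
  by rewrite -{1}AT -trmx_mul Ax trmx0.
Qed.

(* Main.v *)
(* Fix G with G G^T = A, and T with T A T^T = B.  Then T is an OT matrix iff
   A T A is psd: the matrix M = G^T T G satisfies M M^T = G^T B G, and tr M is at
   most the trace of the psd square root of M M^T, with equality only when M is
   that root.  Hence psd transports are OT matrices, and A T A is the same for
   all OT matrices T; as the range of T A lies in R(B), T A itself is unique when
   R(B) meets N(A) trivially.  Conversely, a nonzero vector of R(B) in N(A) gives
   a second OT matrix by composing with a reflection.
   Factoring the off-diagonal block of B as B12 = B11 F, the canonical matrix
   becomes K^T X K with K = U1^T + F U2^T and X the psd solution of
   X A11 X = B11; it transports A to K^T B11 K, which is B exactly when the Schur
   complement vanishes. *)

Require Import Defs.
From HB Require Import structures.
From mathcomp Require Import all_boot all_order all_algebra.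
From mathcomp Require Import complex.
From mathcomp Require Import boolp classical_sets.

Set Implicit Arguments.
Unset Strict Implicit.
Unset Printing Implicit Defensive.

Import Order.TTheory GRing.Theory Num.Theory.
Local Open Scope classical_set_scope.
Local Open Scope ring_scope.

(** * Spectral theorem for symmetric matrices over a real closed field *)

(** The characteristic polynomial has a root [z] in the complex extension. For an eigenvector [v],
    the form [v *m Ac *m vc^T] evaluates both to [z * s] and to [Num.conj z * s], with [s] the
    squared norm of [v], so [z] is real. *)
Lemma symmetric_eigenvalue (R : rcfType) (n : nat) (A : 'M[R]_n.+1) :
  A^T = A -> exists a, eigenvalue A a.
Proof.
move=> AT; pose f := real_complex R; pose Ac := map_mx f A.
have /closed_rootP[z] : size (char_poly Ac) != 1 by rewrite size_char_poly.
rewrite -eigenvalue_root_char => /eigenvalueP[v vA v0].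
pose vc := map_mx Num.conj v; pose s := (v *m vc^T) 0 0.
have cA : map_mx Num.conj Ac = Ac.
  by apply/matrixP => i j; rewrite !mxE; apply: conjc_real.
have vcA : vc *m Ac = Num.conj z *: vc.
  by rewrite /vc -{1}cA -map_mxM vA map_mxZ.
have AcT : Ac^T = Ac by rewrite /Ac map_trmx AT.
have s0 : s != 0.
  apply: contraNneq v0 => /eqP; rewrite /s !mxE psumr_eq0 => [/allP h|j _].
    apply/eqP/rowP => j; rewrite mxE; apply/eqP; rewrite -mul_conjC_eq0.
    by have := h j (mem_index_enum j); rewrite !mxE.
  by rewrite !mxE mul_conjC_ge0.
have zs : z * s = Num.conj z * s.
  transitivity ((v *m Ac *m vc^T) 0 0); first by rewrite vA -scalemxAl mxE.
  by rewrite -AcT -mulmxA -trmx_mul vcA linearZ /= -scalemxAr mxE.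
have zC : Num.conj z = z.
  by apply: (mulIf s0); rewrite zs.
move/CrealP: zC => zR; have [a za] := complex_realP _ zR.
exists a; rewrite eigenvalue_root_char -(fmorph_root f) map_char_poly.
by rewrite -eigenvalue_root_char; apply/eigenvalueP; exists v; rewrite // -/Ac vA za.
Qed.

(** Induction on [n]: split off a unit eigenvector [q], diagonalise the compression of [A] to the
    orthogonal complement of [q], and stack the rows. *)
Lemma symmetric_spectral (R : rcfType) (n : nat) (A : 'M[R]_n) :
  A^T = A ->
  exists2 Q : 'M[R]_n, Q *m Q^T = 1%:M & exists d, A = Q^T *m diag_mx d *m Q.
Proof.
elim: n => [|n IH] in A *.
  by exists 1%:M; [rewrite trmx1 mulmx1 | exists 0; apply/matrixP => -[]].
move=> AT; have [a /eigenvalueP[v vA v0]] := symmetric_eigenvalue AT.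
have rv : \rank <<v>>%MS = 1 by rewrite genmxE rank_rV v0.
(* An orthonormal basis of the line spanned by [v] is [v] normalised. *)
have [q qq qv] := orthonormal_row_basis rv.
have /submxP[c qc] : (q <= v)%MS by rewrite qv genmxE.
have qA : q *m A = a *: q by rewrite qc -mulmxA vA -scalemxAr.
have Aq : A *m q^T = a *: q^T by rewrite -{1}AT -trmx_mul qA linearZ.
have rq : \rank q^T = 1%N.
  apply/eqP; rewrite eqn_leq rank_leq_col lt0n mxrank_eq0.
  apply/eqP => q0; move: qq; rewrite q0 mulmx0 => /matrixP/(_ 0 0)/eqP.
  by rewrite !mxE eqxx eq_sym oner_eq0.
have rk : \rank (kermx q^T) = n by rewrite mxrank_ker rq subn1.
have [W WW Wk] := orthonormal_row_basis rk.
have Wq : W *m q^T = 0 by apply/eqP; rewrite -sub_kermx Wk.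
have qW : q *m W^T = 0 by rewrite -[q]trmxK -trmx_mul Wq trmx0.
have [|P PP [d dP]] := IH (W *m A *m W^T).
  by rewrite !trmx_mul trmxK AT mulmxA.
pose Q : 'M_(1 + n) := col_mx q (P *m W).
have QQ : Q *m Q^T = 1%:M.
  rewrite tr_col_mx mul_col_row qq trmx_mul mulmxA qW mul0mx.
  by rewrite -(mulmxA P) Wq mulmx0 !mulmxA -(mulmxA P) WW mulmx1 PP -scalar_mx_block.
have PK : P^T *m P = 1%:M by apply: mulmx1C.
have QK : Q^T *m Q = 1%:M by apply: mulmx1C.
exists Q => //; exists (row_mx a%:M d).
have QA : Q *m A *m Q^T = diag_mx (row_mx a%:M d).
  rewrite mul_col_mx tr_col_mx mul_col_row qA trmx_mul -!scalemxAl qq.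
  rewrite mulmxA qW mul0mx scaler0 -(mulmxA (P *m W)) Aq.
  rewrite -scalemxAr -(mulmxA P W) Wq mulmx0 scaler0.
  rewrite !mulmxA -2!(mulmxA P) dP !mulmxA PP mul1mx -mulmxA PP mulmx1.
  rewrite diag_mx_row; congr block_mx.
  by apply/matrixP => i j; rewrite !mxE !ord1 eqxx mulr1.
by rewrite -QA !mulmxA QK mul1mx -mulmxA QK mulmx1.
Qed.

(** * Psd matrices, their square roots and pseudoinverses *)

Section Psd.
Variable R : rcfType.
Implicit Types (m n p : nat).

Lemma mulTmx_eq0 m n (N : 'M[R]_(m, n)) : N^T *m N = 0 -> N = 0.
Proof.
move=> NN; apply/matrixP => i j; rewrite mxE; apply/eqP.
move/matrixP/(_ j j)/eqP: NN; rewrite !mxE psumr_eq0 => [/allP h|k _].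
  by have := h i (mem_index_enum i); rewrite mxE -expr2 sqrf_eq0.
by rewrite mxE -expr2 sqr_ge0.
Qed.

Lemma psdmx_sym n (A : 'M[R]_n) : psdmx A -> A^T = A.
Proof. by case. Qed.

Lemma psdmx_cong m n (A : 'M[R]_n) (L : 'M[R]_(n, m)) :
  psdmx A -> psdmx (L^T *m A *m L).
Proof.
case=> AT Age0; split=> [|x]; first by rewrite !trmx_mul trmxK AT mulmxA.
by have := Age0 (L *m x); rewrite trmx_mul !mulmxA.
Qed.

Lemma psdmx_diag n (d : 'rV[R]_n) :
  psdmx (diag_mx d) <-> forall i, 0 <= d 0 i.
Proof.
split=> [[_ dge0] i|dge0].
  have := dge0 (delta_mx i 0); rewrite mul_mx_diag mxE (bigD1 i) //= big1.
    by rewrite addr0 !mxE !eqxx mul1r mulr1.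
  by move=> j ji; rewrite !mxE (negPf ji) mul0r mul0r.
split=> [|x]; first exact: tr_diag_mx.
rewrite mul_mx_diag mxE sumr_ge0 // => i _.
by rewrite !mxE mulrAC mulr_ge0 // -expr2 sqr_ge0.
Qed.

Lemma psdmx_spectral n (A : 'M[R]_n) : psdmx A ->
  exists2 Q : 'M[R]_n, Q *m Q^T = 1%:M &
    exists2 d, A = Q^T *m diag_mx d *m Q & forall i, 0 <= d 0 i.
Proof.
move=> psdA; have [Q QQ [d dA]] := symmetric_spectral (psdmx_sym psdA).
exists Q => //; exists d => //; apply/psdmx_diag.
have := psdmx_cong Q^T psdA.
by rewrite trmxK dA !mulmxA QQ mul1mx -mulmxA QQ mulmx1.
Qed.

Lemma sqrtmx_spec n (A : 'M[R]_n) :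
  psdmx A -> psdmx (sqrtmx A) /\ sqrtmx A *m sqrtmx A = A.
Proof.
move=> /psdmx_spectral[Q QQ [d -> dge0]].
apply: (@xgetPex _ 0 [set S | psdmx S /\ S *m S = _]) => /=.
exists (Q^T *m diag_mx (\row_i Num.sqrt (d 0 i)) *m Q); split.
  by apply/psdmx_cong/psdmx_diag => i; rewrite mxE sqrtr_ge0.
rewrite -!mulmxA (mulmxA Q) QQ mul1mx; congr (_ *m _).
rewrite mulmxA mulmx_diag; congr (diag_mx _ *m _).
by apply/rowP => i; rewrite !mxE -expr2 sqr_sqrtr.
Qed.

(* In an eigenbasis of N with eigenvalues d_i, the i-th row of M has length
   d_i, so that M i i <= d_i, with equality only when the row is d_i e_i. *)
Lemma trace_le_psd n (M N : 'M[R]_n) :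
    psdmx N -> M *m M^T = N *m N^T ->
  \tr M <= \tr N /\ (\tr M = \tr N -> M = N).
Proof.
move=> /psdmx_spectral[Q QQ [d -> dge0]] MN.
have QK : Q^T *m Q = 1%:M by apply: mulmx1C.
have [L LE] : exists L, L = Q *m M *m Q^T by exists (Q *m M *m Q^T).
have LM : M = Q^T *m L *m Q by rewrite LE !mulmxA QK mul1mx -mulmxA QK mulmx1.
have trQ X : \tr (Q^T *m X *m Q) = \tr X.
  by rewrite mxtrace_mulC mulmxA QQ mul1mx.
have row_norm i : \sum_j L i j ^+ 2 = d 0 i ^+ 2.
  have : L *m L^T = diag_mx d *m diag_mx d.
    rewrite LE !trmx_mul trmxK !mulmxA -(mulmxA _ Q^T Q) QK mulmx1.
    rewrite -(mulmxA _ M) MN !trmx_mul trmxK tr_diag_mx !mulmxA QQ mul1mx.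
    by rewrite -!mulmxA QQ mulmx1 (mulmxA Q) QQ mul1mx.
  move/matrixP/(_ i i); rewrite mulmx_diag !mxE eqxx mulr1n -expr2 => <-.
  by apply: eq_bigr => j _; rewrite mxE expr2.
have le_d i : L i i <= d 0 i.
  rewrite (le_trans (ler_norm _)) // -(@ler_pXn2r _ 2) ?nnegrE //.
  rewrite real_normK ?num_real // -row_norm (bigD1 i) //= lerDl sumr_ge0 // => j _.
  exact: sqr_ge0.
rewrite LM !trQ mxtrace_diag; split; first exact: ler_sum.
move=> trL; congr (_ *m _ *m _).
have diagL i : L i i = d 0 i.
  apply/eqP; rewrite eq_sym -subr_eq0.
  have /eqP : \sum_i (d 0 i - L i i) = 0 by rewrite sumrB -trL subrr.
  rewrite psumr_eq0 => [/allP/(_ i)/(_ (mem_index_enum i)) //|j _].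
  by rewrite subr_ge0.
apply/matrixP => i j; rewrite mxE; case: eqVneq => [<-|ij].
  by rewrite mulr1n diagL.
rewrite mulr0n; apply/eqP; rewrite -sqrf_eq0.
have := row_norm i; rewrite (bigD1 i) //= diagL => /(canRL (addKr _)).
rewrite addNr => /eqP; rewrite psumr_eq0 => [/allP/(_ j)|k _]; last first.
  exact: sqr_ge0.
by rewrite mem_index_enum eq_sym ij; apply.
Qed.

(** The trace bound applies in both directions, so the traces agree and the equality case concludes.
    This is the uniqueness of the psd root. *)
Lemma psdmx_gram_inj n (M N : 'M[R]_n) :
  psdmx M -> psdmx N -> M *m M^T = N *m N^T -> M = N.
Proof.
move=> psdM psdN MN; have [le_MN eq_MN] := trace_le_psd psdN MN.
have [le_NM _] := trace_le_psd psdM (esym MN).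
by apply: eq_MN; apply/le_anti/andP.
Qed.

Lemma sqrtmx_uniq n (A S : 'M[R]_n) : psdmx S -> S *m S = A -> sqrtmx A = S.
Proof.
move=> psdS SA; have psdA : psdmx A.
  (* [A] is the congruence of the identity by [S]. *)
  rewrite -SA -[X in X *m _](psdmx_sym psdS) -[X in X *m _]mulmx1.
  by apply: psdmx_cong; split=> [|x]; rewrite ?trmx1 // mulmx1 mxE sumr_ge0 //;
    move=> i _; rewrite mxE -expr2 sqr_ge0.
have [psdQ QA] := sqrtmx_spec psdA.
by apply: psdmx_gram_inj; rewrite // !psdmx_sym // QA SA.
Qed.

Lemma mp_pinvmx_spec n (A : 'M[R]_n) (X := mp_pinvmx A) : A^T = A ->
  [/\ A *m X *m A = A, X *m A *m X = X,
      (A *m X)^T = A *m X & (X *m A)^T = X *m A].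
Proof.
move=> /symmetric_spectral[Q QQ [d dA]].
apply: (@xgetPex _ 0 [set X | [/\ A *m X *m A = A, X *m A *m X = X,
   (A *m X)^T = A *m X & (X *m A)^T = X *m A]]) => /=.
have QX e f : Q^T *m diag_mx e *m Q *m (Q^T *m diag_mx f *m Q) =
    Q^T *m diag_mx (\row_j (e 0 j * f 0 j)) *m Q.
  by rewrite -!mulmxA (mulmxA Q) QQ mul1mx (mulmxA (diag_mx e)) mulmx_diag.
(* Nonzero eigenvalues are inverted; the convention [0^-1 = 0] gives the right value on the
   kernel. *)
exists (Q^T *m diag_mx (\row_i (d 0 i)^-1) *m Q); rewrite dA !QX; split.
- congr (_ *m diag_mx _ *m _); apply/rowP => i; rewrite !mxE.
  by have [->|d0] := eqVneq (d 0 i) 0; rewrite ?mulr0 // divff ?mul1r.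
- congr (_ *m diag_mx _ *m _); apply/rowP => i; rewrite !mxE.
  by have [->|d0] := eqVneq (d 0 i) 0; rewrite ?invr0 ?mulr0 // mulVf ?mul1r.
- by rewrite !trmx_mul trmxK tr_diag_mx mulmxA.
- by rewrite !trmx_mul trmxK tr_diag_mx mulmxA.
Qed.

(** [X^T *m A *m X] is the Gram matrix of [sqrtmx A *m X]. *)
Lemma psdmx_form_eq0 m n (A : 'M[R]_n) (X : 'M[R]_(n, m)) :
  psdmx A -> X^T *m A *m X = 0 -> A *m X = 0.
Proof.
move=> psdA XAX; have [psdH HA] := sqrtmx_spec psdA.
have : sqrtmx A *m X = 0.
  by apply: mulTmx_eq0; rewrite trmx_mul psdmx_sym // mulmxA -(mulmxA _ _ (sqrtmx A)) HA.
by rewrite -{2}HA -mulmxA => ->; rewrite mulmx0.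
Qed.

(** With [C] the cokernel of [M^T *m M], the Gram matrix of [M *m C] vanishes, hence so does
    [M *m C]. *)
Lemma gram_submx m n (M : 'M[R]_(m, n)) : (M <= M^T *m M)%MS.
Proof.
rewrite submxE; apply/eqP/mulTmx_eq0.
by rewrite trmx_mul mulmxA -(mulmxA _ M^T) -mulmxA mulmx_coker mulmx0.
Qed.

(** With [H] the root of [B], the left side is [(H *m U)^T *m H *m V], and [(H *m U)^T] factors
    through its Gram matrix [U^T *m B *m U]. This provides the [F] with B12 = B11 F. *)
Lemma psdmx_block_factor n p q (B : 'M[R]_n) (U : 'M[R]_(n, p))
    (V : 'M[R]_(n, q)) : psdmx B ->
  exists F, U^T *m B *m V = U^T *m B *m U *m F.
Proof.
move=> psdB; have [psdH HB] := sqrtmx_spec psdB.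
have HT := psdmx_sym psdH; set H := sqrtmx B in psdH HB HT.
have UB : U^T *m B = (H *m U)^T *m H by rewrite trmx_mul HT -mulmxA HB.
have /submxP[D /(congr1 trmx)] := gram_submx (H *m U).
rewrite !UB !(trmx_mul D) (trmx_mul _^T) trmxK => HU.
by exists (D^T *m H *m V); rewrite [in LHS]HU !mulmxA.
Qed.

(** * Column spaces, transports and OT matrices *)

Lemma colvec_ext m n (M N : 'M[R]_(m, n)) :
  (forall x : 'cV[R]_n, M *m x = N *m x) -> M = N.
Proof.
move=> MN; apply: trmx_inj; apply/row_matrixP => j.
by rewrite -!tr_col !colE MN.
Qed.

Lemma colspace_sub_mul m n p (M : 'M[R]_(m, n)) (N : 'M[R]_(m, p)) :
  colspace M `<=` colspace N -> exists W, M = N *m W.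
Proof.
move=> MN; suff /submxP[D MD] : (M^T <= N^T)%MS.
  by exists D^T; rewrite -[M]trmxK MD trmx_mul trmxK.
apply/row_subP => j; rewrite -tr_col; apply/colspaceP/MN.
by exists (delta_mx j 0); rewrite // -colE.
Qed.

(** With [H] the root of [A], [B] is the product of [T *m H] with its transpose, so [T *m H], and
    with it [T *m H *m H], has its range in that of [B]. *)
Lemma transport_range n (A B T : 'M[R]_n) :
  psdmx A -> T *m A *m T^T = B -> exists W, T *m A = B *m W.
Proof.
move=> psdA TB; have [psdH HA] := sqrtmx_spec psdA.
have HT := psdmx_sym psdH; set H := sqrtmx A in psdH HA HT.
have := gram_submx (T *m H)^T.
rewrite trmxK trmx_mul HT mulmxA -(mulmxA T) HA TB => /submxP[D HD].
exists (D^T *m H); rewrite -HA !mulmxA; congr (_ *m H).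
have BT : B^T = B by rewrite -TB !trmx_mul trmxK (psdmx_sym psdA) mulmxA.
by apply: trmx_inj; rewrite !trmx_mul HT HD trmxK BT.
Qed.

(** [H] factors through [H *m H = A] on either side, so [H *m T *m H] is a congruence of
    [A *m T *m A]. *)
Lemma psdmx_uncompress n (A T : 'M[R]_n) (H := sqrtmx A) :
  psdmx A -> psdmx (A *m T *m A) -> psdmx (H *m T *m H).
Proof.
move=> psdA psdATA; have [psdH HA] := sqrtmx_spec psdA.
have HT := psdmx_sym psdH; rewrite -/H in psdH HA HT.
have /submxP[D] := gram_submx H; rewrite HT HA => HD.
have HD' : H = A *m D^T by rewrite -{1}HT HD trmx_mul psdmx_sym.
have := psdmx_cong D^T psdATA.
by rewrite trmxK !mulmxA -HD -(mulmxA _ A) -HD'.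
Qed.

Lemma OTmxP n (A B T : 'M[R]_n) : psdmx A -> psdmx B ->
  OTmx A B T <-> T *m A *m T^T = B /\ psdmx (A *m T *m A).
Proof.
move=> psdA psdB; split=> [[TB [G GA trT]]|[TB psdATA]].
  split=> //; pose M := G^T *m T *m G.
  have MM : M *m M^T = G^T *m B *m G.
    by rewrite /M !trmx_mul trmxK -TB -GA !mulmxA.
  have psdC : psdmx (G^T *m B *m G) by apply: psdmx_cong.
  have [psdN NC] := sqrtmx_spec psdC.
  have [|_ MN] := @trace_le_psd _ M _ psdN.
    by rewrite MM (psdmx_sym psdN) NC.
  have psdM : psdmx M.
    by rewrite MN // -trT /M -mulmxA mxtrace_mulC -mulmxA GA mxtrace_mulC.
  have := psdmx_cong G^T psdM; rewrite trmxK /M -GA.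
  by rewrite !mulmxA.
(* Conversely, take the symmetric Green's matrix [H = sqrtmx A]: [H *m T *m H] is then the psd root
   of [H *m B *m H]. *)
split=> //; have [psdH HA] := sqrtmx_spec psdA.
have HT := psdmx_sym psdH; have := psdmx_uncompress psdA psdATA.
set H := sqrtmx A in psdH HA HT * => psdM.
exists H; first by rewrite /green /= HT.
rewrite HT (sqrtmx_uniq psdM); first by rewrite [RHS]mxtrace_mulC mulmxA HA.
by rewrite -[X in _ *m X](psdmx_sym psdM) !trmx_mul HT -TB -HA !mulmxA.
Qed.

Lemma psd_transport_OT n (A B T : 'M[R]_n) : psdmx A -> psdmx B ->
  psd_transport A B T -> OTmx A B T.
Proof.
move=> psdA psdB [psdT TB]; apply/OTmxP => //; split=> //.
by rewrite -{1}(psdmx_sym psdA); apply: psdmx_cong.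
Qed.

(** Quantifying over blocks [Y] of columns lets the condition act directly on matrix equations. *)
Definition trivial_cap n (A B : 'M[R]_n) :=
  forall m (Y : 'M[R]_(n, m)), A *m (B *m Y) = 0 -> B *m Y = 0.

Lemma trivial_capP n (A B : 'M[R]_n) :
  trivial_cap A B <-> colspace B `&` nullspace A = [set 0].
Proof.
split=> [AB|AB m Y ABY].
  apply/seteqP; split=> [x [[y _ <-] /AB //]|_ ->].
  by split; [exists 0; rewrite // mulmx0 | rewrite /nullspace /= mulmx0].
apply: colvec_ext => x; rewrite mul0mx.
suff : [set 0] (B *m Y *m x) by [].
rewrite -AB; split; first by exists (Y *m x); rewrite // mulmxA.
by rewrite /nullspace /= mulmxA ABY mul0mx.
Qed.

(** Put [Z = A *m T *m Y], so that [B *m Y = T *m Z]. If [A *m T *m Z = 0], then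
    [Z^T *m T *m Z = 0], and [T *m Z = 0] because [T] is psd. *)
Lemma psd_transport_cap n (A B T : 'M[R]_n) :
  psd_transport A B T -> psdmx A -> trivial_cap A B.
Proof.
move=> [psdT TB] psdA m Y.
rewrite -TB (psdmx_sym psdT) -!mulmxA => ABY.
apply: psdmx_form_eq0 => //.
by rewrite !trmx_mul (psdmx_sym psdA) (psdmx_sym psdT) -!mulmxA ABY !mulmx0.
Qed.

Lemma OTmx_unique n (A B T T' : 'M[R]_n) : psdmx A -> psdmx B ->
  trivial_cap A B -> OTmx A B T -> OTmx A B T' -> T *m A = T' *m A.
Proof.
move=> psdA psdB capAB /(OTmxP _ psdA psdB)[TB psdT].
move=> /(OTmxP _ psdA psdB)[TB' psdT'].
have [psdH HA] := sqrtmx_spec psdA.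
(* Both sides are psd with the same square, [sqrtmx A *m B *m sqrtmx A]. *)
have eqM : sqrtmx A *m T *m sqrtmx A = sqrtmx A *m T' *m sqrtmx A.
  apply: psdmx_gram_inj; try exact: psdmx_uncompress.
  set H := sqrtmx A in psdH HA *; have HT := psdmx_sym psdH.
  have MM X : H *m X *m H *m (H *m X *m H)^T = H *m (X *m A *m X^T) *m H.
    by rewrite -HA !trmx_mul HT !mulmxA.
  by rewrite !MM TB TB'.
have eqA : A *m T *m A = A *m T' *m A.
  have := congr1 (fun X => sqrtmx A *m X *m sqrtmx A) eqM.
  by rewrite /= !mulmxA HA -!(mulmxA _ (sqrtmx A)) HA.
have [W TW] := transport_range psdA TB.
have [W' TW'] := transport_range psdA TB'.
apply/eqP; rewrite -subr_eq0 TW TW' -mulmxBr; apply/eqP/capAB.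
by rewrite mulmxBr -TW -TW' mulmxBr !mulmxA eqA subrr.
Qed.

(* With y = B z in the kernel of A, the map 1 - c y z^T with c = 2 / (z^T y)
   fixes B by congruence and does not change A T A, but moves T A. *)
Lemma OTmx_unique_cap n (A B T : 'M[R]_n) : psdmx A -> psdmx B ->
    OTmx A B T ->
    (forall T' x, OTmx A B T' -> colspace A x -> T *m x = T' *m x) ->
  forall z : 'cV[R]_n, A *m (B *m z) = 0 -> B *m z = 0.
Proof.
move=> psdA psdB OT uniqT z ABz; have BT := psdmx_sym psdB.
have /(OTmxP _ psdA psdB)[TB psdT] := OT.
have [c0|c0] := eqVneq (z^T *m B *m z) 0; first exact: psdmx_form_eq0.
set c := (z^T *m B *m z) 0 0.
have cE : z^T *m B *m z = c%:M by rewrite [LHS]mx11_scalar.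
have {c0} c0 : c != 0 by apply: contraNneq c0 => c0; rewrite cE c0 raddf0.
pose y := B *m z; pose P := 1%:M - (2 / c) *: (y *m z^T).
have zB : z^T *m B = y^T by rewrite /y trmx_mul BT.
have PT : P^T = 1%:M - (2 / c) *: (z *m y^T).
  by rewrite /P linearB linearZ /= trmx1 trmx_mul trmxK.
have yP : y^T *m P^T = - y^T.
  rewrite PT mulmxBr mulmx1 -scalemxAr mulmxA -zB cE mul_scalar_mx scalerA.
  by rewrite divfK // scaler_nat mulr2n opprD addrA subrr sub0r.
have PB : P *m B *m P^T = B.
  rewrite {1}/P mulmxBl mul1mx -scalemxAl -mulmxA zB mulmxBl -scalemxAl.
  rewrite -mulmxA yP mulmxN scalerN opprK PT mulmxBr mulmx1 -scalemxAr mulmxA.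
  by rewrite subrK.
have OT' : OTmx A B (P *m T).
  apply/OTmxP => //; split.
    by rewrite trmx_mul !mulmxA -(mulmxA P) -(mulmxA P) TB PB.
  by rewrite mulmxA /P mulmxBr mulmx1 -scalemxAr !mulmxA -(mulmxA A) ABz
     !mul0mx scaler0 subr0.
(* The vector [A *m (T^T *m z)] separates the two matrices: [T] sends it to [y] and [P *m T] to
   [- y]. *)
have TAx : T *m (A *m (T^T *m z)) = y by rewrite 2!mulmxA TB.
have /esym := uniqT _ _ OT' (imageT (mulmx A) (T^T *m z)).
rewrite -mulmxA TAx /P mulmxBl mul1mx -scalemxAl -mulmxA /y (mulmxA z^T) cE.
rewrite mul_mx_scalar scalerA divfK // => /eqP.
by rewrite subr_eq addrC -subr_eq subrr eq_sym scaler_eq0 pnatr_eq0 => /eqP.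
Qed.

(** * Adapted bases and the Schur complement *)

Lemma adapted_basesP n (A : 'M[R]_n) (U1 : 'M[R]_(n, \rank A))
    (U2 : 'M[R]_(n, n - \rank A)) : A^T = A -> adapted_bases A U1 U2 ->
  [/\ U1^T *m U1 = 1%:M, A *m U2 = 0, exists W, U1 = A *m W,
      U1^T *m U2 = 0 & U1 *m U1^T + U2 *m U2^T = 1%:M].
Proof.
move=> AT [U1U1 cU1 U2U2 cU2].
have AU2 : A *m U2 = 0.
  apply: colvec_ext => x; rewrite mul0mx -mulmxA.
  by have := imageT (mulmx U2) x; rewrite -[range _]/(colspace U2) cU2.
have [|W UW] := @colspace_sub_mul _ _ _ U1 A; first by rewrite cU1.
have U12 : U1^T *m U2 = 0 by rewrite UW trmx_mul AT -mulmxA AU2 mulmx0.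
have U21 : U2^T *m U1 = 0 by rewrite -[U2^T *m _]trmxK trmx_mul trmxK U12 trmx0.
split=> //; first by exists W.
pose V := col_mx U1^T U2^T.
have VV : V *m V^T = 1%:M.
  by rewrite tr_col_mx !trmxK mul_col_row U1U1 U2U2 U12 U21 -scalar_mx_block.
(* [V] is not square by its type, so completeness of the two bases is obtained by cancelling [V] on
   the left. *)
have fullV : row_full V.
  rewrite /row_full eqn_leq rank_leq_col /=.
  have := mxrankM_maxl V V^T.
  by rewrite VV mxrank1; apply: leq_trans; rewrite -leq_subLR.
apply: (row_full_inj fullV); rewrite mulmx1 mulmxDr !mulmxA !mul_col_mx.
by rewrite U1U1 U2U2 U12 U21 !mul1mx !mul0mx add_col_mx addr0 add0r.
Qed.

(** A matrix [N] killed by the block gives [A *m U1 *m N = 0] by positivity; the columns of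
    [U1 *m N] then lie in both R(A) and N(A), which are orthogonal. *)
Lemma adapted_block_unit n (A : 'M[R]_n) (U1 : 'M[R]_(n, \rank A))
    (U2 : 'M[R]_(n, n - \rank A)) : psdmx A -> adapted_bases A U1 U2 ->
  block_of U1 U1 A \in unitmx.
Proof.
move=> psdA /(adapted_basesP (psdmx_sym psdA))[U1U1 _ [W UW] _ _].
rewrite -row_full_unit -cokermx_eq0; apply/eqP.
have := mulmx_coker (block_of U1 U1 A); move: (cokermx _) => N.
rewrite /block_of -!mulmxA => UAUN.
have AUN : A *m (U1 *m N) = 0.
  apply: psdmx_form_eq0 => //.
  by rewrite trmx_mul -!mulmxA UAUN mulmx0.
suff UN : U1 *m N = 0 by rewrite -[N]mul1mx -U1U1 -mulmxA UN mulmx0.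
apply: mulTmx_eq0; rewrite {1}UW -mulmxA trmx_mul (psdmx_sym psdA).
by rewrite -(mulmxA _ A) AUN mulmx0.
Qed.

Lemma green_unit n (A G : 'M[R]_n) : A \in unitmx -> green A G -> G \in unitmx.
Proof. by move=> uA GA; move: uA; rewrite -GA unitmx_mul => /andP[]. Qed.

(** Block elimination: the [U1] component of the left side is B12 - B11 F = 0, and its [U2]
    component is B22 - B21 F, the Schur complement. *)
Lemma mul_block_schur n (A B : 'M[R]_n) (U1 : 'M[R]_(n, \rank A))
    (U2 : 'M[R]_(n, n - \rank A)) F : psdmx A -> psdmx B ->
    adapted_bases A U1 U2 -> block_of U1 U2 B = block_of U1 U1 B *m F ->
  B *m (U2 - U1 *m F) = U2 *m schur U1 U2 B.
Proof.
move=> psdA psdB /(adapted_basesP (psdmx_sym psdA))[_ _ _ _ UU] B12.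
have BT := psdmx_sym psdB.
have B11T : (block_of U1 U1 B)^T = block_of U1 U1 B.
  by rewrite /block_of !trmx_mul trmxK BT mulmxA.
have B21 : block_of U2 U1 B = F^T *m block_of U1 U1 B.
  by rewrite -[in RHS]B11T -trmx_mul -B12 /block_of !trmx_mul trmxK BT mulmxA.
have [pinvE _ _ _] := mp_pinvmx_spec B11T.
have -> : schur U1 U2 B = U2^T *m (B *m (U2 - U1 *m F)).
  have -> : schur U1 U2 B = block_of U2 U2 B - block_of U2 U1 B *m F.
    by rewrite /schur B12 B21 -[in RHS]pinvE !mulmxA.
  by rewrite /block_of mulmxBr mulmxBr !mulmxA.
have U1B : U1^T *m (B *m (U2 - U1 *m F)) = 0.
  by rewrite mulmxBr mulmxBr !mulmxA -[_ *m F]B12 subrr.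
by rewrite -[LHS]mul1mx -UU mulmxDl -!mulmxA U1B mulmx0 add0r.
Qed.

(** * The canonical transport matrix *)

(** The root of C11 is [E = G^T *m X *m G], and the four blocks simplify to [X], [X *m F],
    [F^T *m X] and [F^T *m X *m F]. *)
Lemma canonical_transportE n p q (B : 'M[R]_n) (U1 : 'M[R]_(n, p))
    (U2 : 'M[R]_(n, q)) (G X : 'M[R]_p) (F : 'M[R]_(p, q))
    (K := U1^T + F *m U2^T) : psdmx B -> G \in unitmx -> psdmx X ->
    X *m (G *m G^T) *m X = block_of U1 U1 B ->
    block_of U1 U2 B = block_of U1 U1 B *m F ->
  canonical_transport U1 U2 B G = K^T *m X *m K.
Proof.
move=> psdB uG psdX XB B12.
have BT := psdmx_sym psdB; have XT := psdmx_sym psdX.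
have B11T : (block_of U1 U1 B)^T = block_of U1 U1 B.
  by rewrite /block_of !trmx_mul trmxK BT mulmxA.
have B21 : block_of U2 U1 B = F^T *m block_of U1 U1 B.
  by rewrite -[in RHS]B11T -trmx_mul -B12 /block_of !trmx_mul trmxK BT mulmxA.
have uGT : G^T \in unitmx by rewrite unitmx_tr.
rewrite /canonical_transport B21 B12.
set B11 := block_of U1 U1 B in XB B11T *.
have psdE : psdmx (G^T *m X *m G) by apply: psdmx_cong.
have EE : G^T *m X *m G *m (G^T *m X *m G) = G^T *m B11 *m G.
  by rewrite -XB !mulmxA.
rewrite (sqrtmx_uniq psdE EE).
have XE : invmx G^T *m (G^T *m X *m G) *m invmx G = X.
  by rewrite !mulmxA mulVmx // mul1mx mulmxK.
have [] := mp_pinvmx_spec (psdmx_sym psdE).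
move: (mp_pinvmx _) => Y; have ET := psdmx_sym psdE.
set E := G^T *m X *m G in EE ET XE *; clearbody E B11 => EYE _ EYT YET.
(* The symmetry of [Y *m E] and [E *m Y] turns [E *m Y *m E = E] into this identity and the next. *)
have YEE : Y *m E *m E = E.
  by apply: trmx_inj; rewrite trmx_mul YET ET mulmxA.
have EEY : E *m E *m Y = E.
  by apply: trmx_inj; rewrite -mulmxA trmx_mul EYT ET.
have BE : G^T *m B11 = E *m E *m invmx G by rewrite EE mulmxK.
have BE' : B11 *m G = invmx G^T *m E *m E.
  by rewrite -mulmxA EE !mulmxA mulVmx // mul1mx.
have -> : invmx G^T *m Y *m G^T *m (B11 *m F) = X *m F.
  rewrite !mulmxA -(mulmxA _ G^T) BE !mulmxA -(mulmxA _ Y) -(mulmxA _ (Y *m E)).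
  by rewrite YEE XE.
have -> : F^T *m B11 *m G *m Y *m invmx G = F^T *m X.
  rewrite -(mulmxA F^T) BE' -!mulmxA (mulmxA E E) (mulmxA (E *m E)) EEY.
  by rewrite (mulmxA (invmx _)) XE.
have -> : F^T *m B11 *m G *m (Y *m Y *m Y) *m G^T *m (B11 *m F) = F^T *m X *m F.
  rewrite (mulmxA _ B11) -(mulmxA _ G^T B11) BE -(mulmxA F^T B11) BE' -!mulmxA.
  have EEYr r (Z : 'M_(_, r)) : E *m (E *m (Y *m Z)) = E *m Z.
    by rewrite !mulmxA EEY.
  have YEEr r (Z : 'M_(_, r)) : Y *m (E *m (E *m Z)) = E *m Z.
    by rewrite !mulmxA YEE.
  have EYEr r (Z : 'M_(_, r)) : E *m (Y *m (E *m Z)) = E *m Z.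
    by rewrite !mulmxA EYE.
  by rewrite EEYr YEEr EYEr -XE !mulmxA.
rewrite XE mul_row_block tr_row_mx mul_row_col /K [(_ + _)^T]linearD /= trmx_mul !trmxK.
by rewrite !mulmxDl !mulmxDr !mulmxA addrACA.
Qed.

Lemma canonical_factors n p q (B : 'M[R]_n) (U1 : 'M[R]_(n, p))
    (U2 : 'M[R]_(n, q)) (G : 'M[R]_p) : psdmx B -> G \in unitmx ->
  exists X F, [/\ psdmx X, X *m (G *m G^T) *m X = block_of U1 U1 B &
                  block_of U1 U2 B = block_of U1 U1 B *m F].
Proof.
move=> psdB uG; have [F B12] := psdmx_block_factor U1 U2 psdB.
have uGT : G^T \in unitmx by rewrite unitmx_tr.
pose C := G^T *m block_of U1 U1 B *m G.
have [psdE EE] : psdmx (sqrtmx C) /\ sqrtmx C *m sqrtmx C = C.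
  by apply/sqrtmx_spec/psdmx_cong/psdmx_cong.
exists (invmx G^T *m sqrtmx C *m invmx G), F; split=> //.
  by rewrite -trmx_inv; apply: psdmx_cong.
rewrite !mulmxA mulmxKV // mulmxK // -(mulmxA _ (sqrtmx C) (sqrtmx C)) EE /C.
by rewrite !mulmxA mulVmx // mul1mx mulmxK.
Qed.

(** [W1] and [W2] are the orthogonal changes of basis. They turn the data [X], [F] into
    [W1^T *m X *m W1], [W1^T *m F *m W2] and [K] into [W1^T *m K], leaving [K^T *m X *m K] fixed. A
    Green's matrix enters only through its product with its transpose. *)
Lemma canonical_transport_indep n (A B : 'M[R]_n)
    (U1 V1 : 'M[R]_(n, \rank A)) (U2 V2 : 'M[R]_(n, n - \rank A))
    (G H : 'M[R]_(\rank A)) : psdmx A -> psdmx B ->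
    adapted_bases A U1 U2 -> adapted_bases A V1 V2 ->
    green (block_of U1 U1 A) G -> green (block_of V1 V1 A) H ->
  canonical_transport U1 U2 B G = canonical_transport V1 V2 B H.
Proof.
move=> psdA psdB bU bV GA HA; have AT := psdmx_sym psdA.
have uG := green_unit (adapted_block_unit psdA bU) GA.
have uH := green_unit (adapted_block_unit psdA bV) HA.
have [X [F [psdX XB B12]]] := canonical_factors U1 U2 psdB uG.
rewrite (canonical_transportE psdB uG psdX XB B12).
have [U1U1 AU2 [W UW] U12 UU] := adapted_basesP AT bU.
have [V1V1 AV2 [W' VW] V12 VV] := adapted_basesP AT bV.
pose W1 := U1^T *m V1; pose W2 := U2^T *m V2.
have U21 : U2^T *m V1 = 0.
  by rewrite VW -[U2^T *m _]trmxK trmx_mul (trmx_mul A) AT trmxK -mulmxA AU2 mulmx0 trmx0.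
have V12' : U1^T *m V2 = 0 by rewrite UW trmx_mul AT -mulmxA AV2 mulmx0.
have V21 : V2^T *m U1 = 0 by rewrite -[_ *m U1]trmxK trmx_mul trmxK V12' trmx0.
have V1E : V1 = U1 *m W1.
  by rewrite -[LHS]mul1mx -UU mulmxDl -!mulmxA U21 mulmx0 addr0.
have V2E : V2 = U2 *m W2.
  by rewrite -[LHS]mul1mx -UU mulmxDl -!mulmxA V12' mulmx0 add0r.
have W1W1 : W1 *m W1^T = 1%:M.
  rewrite /W1 trmx_mul trmxK mulmxA -(mulmxA U1^T) -[V1 *m _](addrK (V2 *m V2^T)).
  by rewrite VV mulmxBr mulmxBl mulmx1 -!mulmxA V21 !mulmx0 subr0.
have U2U2 : U2^T *m U2 = 1%:M by case: bU.
have W2W2 : W2 *m W2^T = 1%:M.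
  rewrite /W2 trmx_mul trmxK mulmxA -(mulmxA U2^T) -[V2 *m _](addKr (V1 *m V1^T)).
  by rewrite VV mulmxDr mulmxDl mulmx1 mulmxN mulmxA U21 !mul0mx oppr0 mul0mx add0r.
clearbody W1 W2; have cW (M : 'M[R]_n) : block_of V1 V1 M = W1^T *m block_of U1 U1 M *m W1.
  by rewrite /block_of V1E trmx_mul !mulmxA.
rewrite (@canonical_transportE _ _ _ _ _ _ _ (W1^T *m X *m W1) (W1^T *m F *m W2)) //.
- have -> : V1^T + W1^T *m F *m W2 *m V2^T = W1^T *m (U1^T + F *m U2^T).
    rewrite V1E V2E !trmx_mul mulmxDr; congr (_ + _).
    by rewrite !mulmxA -(mulmxA _ W2) W2W2 mulmx1.
  rewrite trmx_mul trmxK !mulmxA -(mulmxA _ W1) W1W1 mulmx1.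
  by rewrite -(mulmxA _ W1) W1W1 mulmx1.
- exact: psdmx_cong.
- rewrite HA !cW -GA -XB !mulmxA -(mulmxA _ W1) W1W1 mulmx1.
  by rewrite -(mulmxA _ W1 W1^T) W1W1 mulmx1.
- transitivity (W1^T *m (block_of U1 U1 B *m F) *m W2).
    by rewrite -B12 /block_of V1E V2E trmx_mul !mulmxA.
  by rewrite cW !mulmxA -(mulmxA _ W1 W1^T) W1W1 mulmx1.
Qed.

Lemma canonical_transport_psd n (A B : 'M[R]_n) (U1 : 'M[R]_(n, \rank A))
    (U2 : 'M[R]_(n, n - \rank A)) (G : 'M[R]_(\rank A)) :
    psdmx A -> psdmx B -> adapted_bases A U1 U2 -> schur U1 U2 B = 0 ->
    green (block_of U1 U1 A) G ->
  psd_transport A B (canonical_transport U1 U2 B G) /\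
  (\rank (canonical_transport U1 U2 B G) <= \rank B)%N.
Proof.
move=> psdA psdB bU S0 GA.
have uG := green_unit (adapted_block_unit psdA bU) GA.
have [X [F [psdX XB B12]]] := canonical_factors U1 U2 psdB uG.
rewrite (canonical_transportE psdB uG psdX XB B12).
have := mul_block_schur psdA psdB bU B12; rewrite S0 mulmx0 mulmxBr.
move=> /eqP; rewrite subr_eq0 => /eqP BU2.
have [U1U1 AU2 _ U12 UU] := adapted_basesP (psdmx_sym psdA) bU.
set K := U1^T + _.
have BK : B *m U1 *m K = B.
  by rewrite /K mulmxDr !mulmxA -(mulmxA B U1 F) -BU2 -!mulmxA -mulmxDr UU mulmx1.
have BK' : K^T *m block_of U1 U1 B *m K = B.
  rewrite /block_of -!mulmxA (mulmxA B) BK mulmxA -[RHS](psdmx_sym psdB) -[in RHS]BK.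
  by rewrite !trmx_mul psdmx_sym // mulmxA.
have KAK : K *m A *m K^T = G *m G^T.
  have U2A : U2^T *m A = 0 by rewrite -[X in _ *m X](psdmx_sym psdA) -trmx_mul AU2 trmx0.
  rewrite GA /K mulmxDl -(mulmxA F) U2A mulmx0 addr0 [(_ + _)^T]linearD /= trmx_mul !trmxK.
  by rewrite mulmxDr (mulmxA _ U2) -(mulmxA _ A U2) AU2 mulmx0 mul0mx addr0.
split.
  split; first exact: psdmx_cong.
  by rewrite !trmx_mul trmxK (psdmx_sym psdX) -[RHS]BK' -XB -KAK !mulmxA.
(* For the rank bound: B11 is the Gram matrix of [G^T *m X] with [G] invertible, so the rows of [X]
   lie in the row space of B11, a compression of [B]. *)
have /submxP[D XD] : (X <= block_of U1 U1 B)%MS.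
  have -> : block_of U1 U1 B = (G^T *m X)^T *m (G^T *m X).
    by rewrite trmx_mul trmxK (psdmx_sym psdX) -XB !mulmxA.
  apply: submx_trans (gram_submx _).
  by apply/submxP; exists (invmx G^T); rewrite mulKmx // unitmx_tr.
apply: leq_trans (mxrankM_maxl _ _) _; apply: leq_trans (mxrankM_maxr _ _) _.
rewrite XD; apply: leq_trans (mxrankM_maxr _ _) _.
by apply: leq_trans (mxrankM_maxl _ _) _; apply: mxrankM_maxr.
Qed.

End Psd.

(** * The cycle of equivalences, optimality, minimal rank and independence of choices *)

Theorem theorem3p3 (R : rcfType) (n : nat) (A B : 'M[R]_n)
    (psdA : psdmx A) (psdB : psdmx B)
    (U1 : 'M[R]_(n, \rank A)) (U2 : 'M[R]_(n, n - \rank A))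
    (basesU : adapted_bases A U1 U2) :
  [/\ [<-> psd_transport A B !=set0;
           OTmx A B !=set0 /\
             (forall T T' x, OTmx A B T -> OTmx A B T' -> colspace A x ->
                T *m x = T' *m x);
           schur U1 U2 B = 0;
           colspace B = colspace (B *m A);
           colspace B `&` nullspace A = [set 0]],
      psd_transport A B `<=` OTmx A B,
      psd_transport A B !=set0 ->
        forall G11, green (block_of U1 U1 A) G11 ->
        let S := canonical_transport U1 U2 B G11 in
        [/\ psd_transport A B S,
            \rank S = \rank (sqrtmx B *m sqrtmx A) &
            forall T, psd_transport A B T -> (\rank S <= \rank T)%N] &
      forall V1 V2 G11 H11, adapted_bases A V1 V2 ->
        green (block_of U1 U1 A) G11 -> green (block_of V1 V1 A) H11 ->
        canonical_transport U1 U2 B G11 = canonical_transport V1 V2 B H11].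
Proof.
have AT := psdmx_sym psdA; have BT := psdmx_sym psdB.
have [U1U1 AU2 [W UW] U12 UU] := adapted_basesP AT basesU.
have [F B12] := psdmx_block_factor U1 U2 psdB.
(* By [mul_block_schur], the columns of [U2 *m schur U1 U2 B] lie in R(B), and those of [U2] lie in
   N(A). *)
have cap_schur : trivial_cap A B -> schur U1 U2 B = 0.
  move=> capAB; have BS := mul_block_schur psdA psdB basesU B12.
  have U2S : U2 *m schur U1 U2 B = 0.
    by rewrite -BS; apply: capAB; rewrite BS mulmxA AU2 mul0mx.
  have [_ _ U2U2 _] := basesU.
  by rewrite -[schur _ _ _]mul1mx -U2U2 -mulmxA U2S mulmx0.
(* Here [B *m U2 = B *m U1 *m F], so [B] factors through [B *m U1], where [U1 = A *m W]. *)
have schur_mul : schur U1 U2 B = 0 -> exists V, B = B *m A *m V.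
  move=> S0; have := mul_block_schur psdA psdB basesU B12.
  rewrite S0 mulmx0 mulmxBr => /eqP; rewrite subr_eq0 => /eqP BU2.
  exists (W *m (U1^T + F *m U2^T)).
  rewrite mulmxA -(mulmxA B A) -UW mulmxDr -[LHS]mulmx1 -UU mulmxDr !mulmxA BU2.
  by rewrite !mulmxA.
have exG : exists G, green (block_of U1 U1 A) G.
  have psdA11 : psdmx (block_of U1 U1 A) by apply: psdmx_cong.
  exists (sqrtmx (block_of U1 U1 A)).
  by have [psdH HA] := sqrtmx_spec psdA11; rewrite /green /= psdmx_sym.
split.
- tfae.
  + move=> [T ST]; have capAB := psd_transport_cap ST psdA.
    split; first by exists T; apply: psd_transport_OT.
    move=> T1 T2 _ OT1 OT2 [x _ <-].
    by rewrite !mulmxA (OTmx_unique psdA psdB capAB OT1 OT2).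
  + move=> [[T OT] uniqT]; apply/cap_schur/trivial_capP/seteqP; split=> [x|_ ->].
      move=> [[z _ <-]]; apply: (OTmx_unique_cap psdA psdB OT) => T' y OT'.
      exact: uniqT.
    by split; [exists 0; rewrite // mulmx0 | rewrite /nullspace /= mulmx0].
  + move=> /schur_mul[V BV]; apply/seteqP; split=> _ [x _ <-].
      by exists (V *m x); rewrite // mulmxA -BV.
    by exists (A *m x); rewrite // mulmxA.
  + move=> rBA; apply/trivial_capP => m Y ABY.
    have [|V BV] := @colspace_sub_mul _ _ _ _ B (B *m A); first by rewrite -rBA.
    (* Transposing [B = B *m A *m V] gives [B = V^T *m A *m B]. *)
    by rewrite -BT BV !trmx_mul AT BT -!mulmxA ABY mulmx0.
  + move=> /trivial_capP/cap_schur S0; have [G GA] := exG.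
    exists (canonical_transport U1 U2 B G).
    by case: (canonical_transport_psd psdA psdB basesU S0 GA).
- by move=> T; apply: psd_transport_OT.
- move=> [T0 ST0] G GA S.
  have S0 := cap_schur (psd_transport_cap ST0 psdA).
  have [SS rS] := canonical_transport_psd psdA psdB basesU S0 GA.
  (* Every transport has rank at least that of [B], and [S] attains this bound. *)
  have rB T : psd_transport A B T -> (\rank B <= \rank T)%N.
    by case=> _ <-; rewrite -mulmxA mxrankM_maxl.
  have rSB : \rank S = \rank B by apply/eqP; rewrite eqn_leq rS rB.
  split=> //; last by move=> T /rB; rewrite rSB.
  have [V BV] := schur_mul S0.
  have [[psdb bB] [psda aA]] := (sqrtmx_spec psdB, sqrtmx_spec psdA).
  rewrite rSB; apply/eqP; rewrite eqn_leq; apply/andP; split.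
    (* Since [B = B *m A *m V], placing [sqrtmx B *m sqrtmx A] inside [B *m A] bounds the rank of
       [B] by its rank. *)
    have BA : B *m A = sqrtmx B *m (sqrtmx B *m sqrtmx A) *m sqrtmx A.
      by rewrite -{1}bB -{1}aA !mulmxA.
    rewrite {1}BV; apply: leq_trans (mxrankM_maxl _ _) _; rewrite BA.
    by apply: leq_trans (mxrankM_maxl _ _) _; apply: mxrankM_maxr.
  apply: leq_trans (mxrankM_maxl _ _) _.
  by have := mxrankS (gram_submx (sqrtmx B)); rewrite (psdmx_sym psdb) bB.
- move=> V1 V2 G11 H11 basesV GA HA.
  exact: (canonical_transport_indep psdA psdB basesU basesV GA HA).
Qed.
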